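(* Let $M$ be a shifted multicomplex on $X=\{x_1<x_2<\dots<x_n\}$ and let $k\ge 1$ be an integer. Then, up to the multiplicity of the eigenvalue $0$, $$\boldsymbol{s}'_{k-1}(M)=\sum_{\substack{p^2\in M\\ 2\deg(p)\le k}} \boldsymbol{d}_{k-2\deg(p)}\bigl(M^{(p^2)}\bigr)^T ,$$ where the sum is over monomials $p$, it denotes multiset sum (multiplicities are added), and $^T$ denotes the conjugate partition. In particular, all eigenvalues of the operators $L'_d$ ($d\ge 0$) of $M$ are non-negative integers. Equivalently, with $\underline{b}=1$ if $b$ is odd and $\underline{b}=0$ if $b$ is even, and $\underline{(\alpha_1,\dots,\alpha_n)}=(\underline{\alpha_1},\dots,\underline{\alpha_n})$, $$\boldsymbol{s}'_{k-1}(M)^T=\sum_{x_1^{\alpha_1}\cdots x_n^{\alpha_n}\in M_k}\underline{(\alpha_1,\dots,\alpha_n)},$$ where this last sum is the componentwise sum of vectors.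
   Context: Let $X=\{x_1,\dots,x_n\}$ be a finite set totally ordered by $x_1<\dots<x_n$, and let $[X]$ be the free abelian monoid of monomials $x_1^{a_1}\cdots x_n^{a_n}$, with total degree $\deg(x_1^{a_1}\cdots x_n^{a_n})=\sum_i a_i$. A multicomplex on $X$ is a finite subset $M\subset[X]$ closed under taking divisors; $M_\ell$ is the set of its monomials of total degree $\ell$. $M$ is shifted (relative to its support) if $x_jm\in M$, $i<j$ and $x_i\in M$ imply $x_im\in M$. Boundary operator: $\partial_d:\mathbb{R}M_d\to\mathbb{R}M_{d-1}$ is the linear map given by $$\partial_d(x_1^{a_1}\cdots x_n^{a_n})=\sum_{j=1}^n(-1)^{a_1+\dots+a_{j-1}}\,r_j\,x_1^{a_1}\cdots x_j^{a_j-1}\cdots x_n^{a_n},$$ where $r_j=1$ if $a_j$ is odd and $r_j=0$ if $a_j$ is even. Let $\partial_{d}^*:\mathbb{R}M_{d-1}\to\mathbb{R}M_{d}$ be its transpose with respect to the monomial bases, and let $L'_d=\partial_{d+1}\partial_{d+1}^*:\mathbb{R}M_d\to\mathbb{R}M_d$. $\boldsymbol{s}'_d(M)$ is the multiset of eigenvalues of $L'_d$ (real and nonnegative), listed with multiplicity and identified with its weakly decreasing rearrangement. For a monomial $p$ with $p^2\in M$, $M^{(p^2)}=\{q \text{ square-free monomial}: p^2q\in M\}$; it is a simplicial complex, regarded as a multicomplex of square-free monomials (the empty simplex, the monomial $1$, has degree $0$). For a multicomplex $N$ on $X$, $\boldsymbol{d}_k(N)=(d_1,\dots,d_n)$, where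 $d_j$ is the number of monomials in $N_k$ divisible by $x_j$. Convention: partitions differing only in the number of zero parts are identified; a tuple of non-negative integers is regarded as the partition given by its weakly decreasing rearrangement. *)

(* Defs.v *)
From HB Require Import structures.
From mathcomp Require Import all_boot all_order all_algebra.
From mathcomp Require Import finmap.
From mathcomp Require Import mpoly.
From mathcomp Require Import reals.
From mathcomp Require Import complex.

Set Implicit Arguments.
Unset Strict Implicit.
Unset Printing Implicit Defensive.

Import Order.TTheory GRing.Theory Num.Theory.
Local Open Scope fset_scope.
Local Open Scope ring_scope.

(* Monomials in x_1 < ... < x_n are exponent vectors 'X_{1..n}, written
   additively: U_(i) is x_i, m1 + m2 is the product, p *+ 2 is the square of p,
   (m1 <= m2)%MM is divisibility and mdeg is the total degree. *)

Section Multicomplexes.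
Variable n : nat.
Implicit Types (M N : {fset 'X_{1..n}}) (m p q : 'X_{1..n}).

Definition multicomplex M : Prop :=
  forall m m', (m' <= m)%MM -> m \in M -> m' \in M.

Definition shifted M : Prop :=
  forall (i j : 'I_n) m, (i < j)%N ->
    (U_(j) + m)%MM \in M -> U_(i)%MM \in M -> (U_(i) + m)%MM \in M.

Definition level M (d : nat) : {fset 'X_{1..n}} := [fset m in M | mdeg m == d].

Definition squarefree m : bool := [forall j : 'I_n, (m j <= 1)%N].

(* In the next two definitions, the restriction to elements of M costs nothing
   for a multicomplex: see mem_square_roots and mem_sqlink. *)
Definition square_roots M : {fset 'X_{1..n}} :=
  [fset p in M | (p *+ 2)%MM \in M].

(* M^(p^2) *)
Definition sqlink M p : {fset 'X_{1..n}} :=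
  [fset q in M | squarefree q && ((p *+ 2 + q)%MM \in M)].

Lemma mem_square_roots M p :
  multicomplex M -> (p \in square_roots M) = ((p *+ 2)%MM \in M).
Proof.
move=> cM; rewrite !inE /=; apply: andb_idl => /cM; apply.
by apply/mnm_lepP => i; rewrite mulmnE leq_pmulr.
Qed.

Lemma mem_sqlink M p q :
  multicomplex M ->
  (q \in sqlink M p) = squarefree q && ((p *+ 2 + q)%MM \in M).
Proof.
move=> cM; rewrite !inE /=; apply: andb_idl => /andP[_ /cM]; apply.
exact: lem_addl.
Qed.

Definition degree_vector N (k : nat) : seq nat :=
  [seq #|` [fset m in level N k | (U_(j) <= m)%MM] | | j : 'I_n].

Definition parity_vector_sum M (k : nat) : seq nat :=
  [seq \sum_(m <- level M k) odd (m j) | j : 'I_n]%N.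

End Multicomplexes.

(* Equality of multisets up to the multiplicity of 0; for sequences of natural
   numbers, this is also equality, up to the number of zero parts, of the
   partitions obtained by sorting. *)
Definition eq_upto0 (V : nmodType) (s t : seq V) : bool :=
  perm_eq [seq a <- s | a != 0] [seq a <- t | a != 0].

(* Conjugate of the partition obtained by sorting s: its (j+1)-st part is the
   number of parts of s that are at least j+1. *)
Definition conj_part (s : seq nat) : seq nat :=
  mkseq (fun j => count (fun a => j < a)%N s) (\max_(a <- s) a)%N.

(* s is a weakly decreasing list of the roots, with multiplicity, of the
   characteristic polynomial of A, which moreover splits. *)
Definition is_spectrum (R : rcfType) (r : nat) (A : 'M[R]_r) (s : seq R) :
  bool := sorted >=%R s && (char_poly A == \prod_(a <- s) ('X - a%:P)).

Lemma sym_spectrum (R : rcfType) (r : nat) (A : 'M[R]_r) :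
  A^T = A -> exists s, is_spectrum A s.
Proof.
move=> symA; pose f := real_complex R; pose Ac := map_mx f A.
have [r0 /esym def_p] := closed_field_poly_normal (char_poly Ac).
rewrite (monicP (char_poly_monic _)) scale1r in def_p.
have realz z : z \in r0 -> f (complex.Re z) = z.
  move=> r0z; have: root (char_poly Ac) z by rewrite -def_p root_prod_XsubC.
  rewrite -eigenvalue_root_char => /eigenvalueP[v vA v0].
  pose w : 'cV_r := (map_mx Num.conj v)^T.
  have Aw : Ac *m w = z^* *: w.
    have Acr : map_mx Num.conj Ac = Ac.
      by apply/matrixP=> i j; rewrite !mxE conj_Creal // complex_real.
    have AcT : Ac^T = Ac.
      by apply/matrixP=> i j; rewrite !mxE -[in LHS]symA mxE.
    by rewrite -{1}AcT /w -trmx_mul -{1}Acr -map_mxM vA map_mxZ linearZ.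
  have vw0 : (v *m w) 0 0 != 0.
    rewrite mxE; apply: contraNneq v0 => /eqP.
    rewrite psumr_eq0; last by move=> i _; rewrite !mxE mul_conjC_ge0.
    move=> /allP v0; apply/eqP/rowP => i; rewrite [RHS]mxE.
    have := v0 i (mem_index_enum _); rewrite /= !mxE mul_conjC_eq0.
    by move/eqP.
  have : z * (v *m w) 0 0 = z^* * (v *m w) 0 0.
    have := mulmxA v Ac w; rewrite vA Aw -scalemxAl -scalemxAr.
    by move/matrixP/(_ 0 0); rewrite !mxE.
  move/(mulIf vw0)/esym/eqP; rewrite -CrealE.
  exact: RRe_real.
pose s := sort >=%R [seq complex.Re z | z <- r0]; exists s.
rewrite /is_spectrum sort_sorted; last by move=> a b; exact: le_total.
have /permPl s_perm := perm_sort >=%R [seq complex.Re z | z <- r0].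
rewrite (perm_big _ s_perm) /= big_map; apply/eqP.
apply: (map_poly_inj f); rewrite map_char_poly -/Ac -def_p rmorph_prod /=.
apply: eq_big_seq => z r0z.
rewrite rmorphB /= map_polyX map_polyC /=; congr (_ - _%:P).
by rewrite -[LHS]realz.
Qed.

Section Laplacian.
Variables (R : rcfType) (n : nat) (M : {fset 'X_{1..n}}).

(* The boundary of the monomial x^a, as a polynomial whose monomials divide x^a.
   The truncated subtraction is harmless: odd (a j) vanishes when a j = 0. *)
Definition boundary (a : 'X_{1..n}) : {mpoly R[n]} :=
  \sum_(j < n)
    ((-1) ^+ (\sum_(i < n | (i < j)%N) a i)%N * (odd (a j))%:R)
      *: 'X_[a - U_(j)].

(* The matrix of boundary_{d+1} : R M_{d+1} -> R M_d in the monomial bases,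
   acting on column vectors. *)
Definition boundary_mx (d : nat) :
  'M[R]_(#|{: level M d}|, #|{: level M d.+1}|) :=
  \matrix_(i, j) (boundary (val (enum_val j)))@_(val (enum_val i)).

(* L'_d *)
Definition laplacian (d : nat) : 'M[R]_#|{: level M d}| :=
  boundary_mx d *m (boundary_mx d)^T.

Lemma laplacian_sym d : (laplacian d)^T = laplacian d.
Proof. by rewrite /laplacian trmx_mul trmxK. Qed.

(* s'_d(M) *)
Definition spectrum (d : nat) : seq R :=
  xchoose (sym_spectrum (laplacian_sym d)).

Lemma spectrumP d : is_spectrum (laplacian d) (spectrum d).
Proof. exact: xchooseP. Qed.

End Laplacian.

(* Main.v *)
Require Import Defs.
From mathcomp Require Import all_boot all_order all_algebra.
From mathcomp Require Import finmap mpoly reals.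
From mathcomp Require Import zify ring.

(** Write a monomial of M as p^2 q with q square-free.  The boundary of p^2 q
    is p^2 times the simplicial boundary of q, so everything happens on the
    pairs (p, A), where A is the set of variables of odd exponent, and boundary
    is the sum over the vertices j of an operator [low j] that deletes j from A
    with a sign.  These operators satisfy the Clifford relations: they square to
    0, anticommute with each other, anticommute with the transposes of the
    others, and [low j *m (low j)^T] projects onto the A that avoid j.

    For a family F of pairs put D = bd *m ind F, the boundary restricted to F.
    Knowing the nonzero eigenvalues of D D^T is knowing det(1 + u D D^T) for all
    u > 0, and the theorem says that, for a family closed under replacing a
    vertex of A by an earlier one,
      det(1 + u D D^T) = \prod_c ((1 + u (c+1)) / (1 + u c)) ^ e_c,
    where e_c is the number of (p, A) in F such that A contains the c-th vertex.
    Indeed an eigenvalue b contributes 1 + u b, which telescopes into the factors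
    with c < b; so the formula means that exactly e_c eigenvalues exceed c, that
    is, that the spectrum is the conjugate of (e_0, e_1, ...).

    The formula is proved by induction on the list of vertices
    ([det_up_laplacian]).  Let v be the first vertex, G the link of v and F0 the
    members of F without v.  Shiftedness puts the shadow of F0 inside G, so F is
    a near-cone with apex v, and D is the product of 1 - L^T B and Q L + A, where
    Q projects onto G, L = [low v], and A and B are the boundaries of F0 and of G.
    Since B A = 0, the determinant splits ([det_cone]):
      det(1 + u D D^T) = (1+u)^|G| det(1 + s A A^T) det(1 + s B B^T),
    with s = u/(1+u): the eigenvalues of F0 and G, padded with zeros to |G| = e_0
    in number, are raised by 1.  Since the substitution s = u/(1+u) sends the
    c-th factor to the (c+1)-st, the formula for F follows from those for F0
    and G.

    Shiftedness also makes e decreasing, so the conjugate of e is described by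
    its numbers of parts exceeding c, which are linear in e.  As e is the sum
    over p of the degree vectors of the M^(p^2), each decreasing on the vertices
    of M, the decomposition over p is a comparison of these numbers. *)

Set Implicit Arguments.
Unset Strict Implicit.
Unset Printing Implicit Defensive.

Import Order.TTheory GRing.Theory Num.Theory.
Local Open Scope ring_scope.

(** * Conjugate partitions through threshold counts *)

Section Conjugation.
Local Open Scope nat_scope.
Implicit Types (d s t : seq nat).

(** The cells (j, c) of the Young diagram of d, read by rows and by columns. *)
Lemma ltn_nth_count d j c :
  sorted geq d -> (j < nth 0 d c) = (c < count (ltn j) d).
Proof.
elim: d c => [|a d IHd] c; first by rewrite nth_nil.
rewrite [sorted _ _]/= path_sortedE; last exact/rev_trans/leq_trans.
case/andP=> le_a sd /=.
have [lt_ja | le_aj] := ltnP j a.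
  by case: c => [|c] //=; rewrite IHd.
have -> : count (ltn j) d = 0.
  apply/eqP; rewrite eqn0Ngt -has_count; apply/hasPn => b /(allP le_a) /= le_ba.
  by rewrite -leqNgt (leq_trans le_ba).
case: c => [|c] /=; first by rewrite ltnNge le_aj.
rewrite ltn0; apply/negbTE; rewrite -leqNgt.
have [lt_c|/(nth_default 0)->//] := ltnP c (size d).
by apply: leq_trans le_aj; apply: (allP le_a); apply: mem_nth.
Qed.

Lemma count_iota_gtn m N : count (gtn m) (iota 0 N) = minn m N.
Proof.
elim: N => [|N IHN]; first by rewrite minn0.
by rewrite -addn1 iotaD count_cat IHN /= add0n !addn0; lia.
Qed.

Lemma nth_leq_bigmax s c : (nth 0 s c <= \max_(a <- s) a)%N.
Proof.
have [lt_c|/(nth_default 0)->//] := ltnP c (size s).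
exact: (@leq_bigmax_seq _ _ xpredT id _ (mem_nth 0 lt_c)).
Qed.

Lemma count_conj_part d c :
  sorted geq d -> count (ltn c) (conj_part d) = nth 0 d c.
Proof.
move=> sd; rewrite /conj_part /mkseq count_map.
rewrite -[RHS](minn_idPl (nth_leq_bigmax d c)) -count_iota_gtn.
by apply: eq_count => j /=; rewrite ltn_nth_count.
Qed.

(** The multiplicity of a > 0 is the number of parts exceeding a - 1 minus the
    number exceeding a. *)
Lemma eq_upto0_count s t :
  (forall c, count (ltn c) s = count (ltn c) t) -> eq_upto0 s t.
Proof.
move=> eq_st; apply/allP => a _ /=; apply/eqP; rewrite !count_filter.
case: a => [|a].
  by rewrite !(eq_count (a2 := pred0)) ?count_pred0 // => x /=; case: eqP => // ->.
have count_mem1 r : count (predI (pred1 a.+1) (fun x => x != 0%R)) r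
                    + count (ltn a.+1) r = count (ltn a) r.
  by elim: r => //= x r <-; case: (ltngtP x a.+1) => [||->] //=; lia.
by apply: (@addIn (count (ltn a.+1) s)); rewrite count_mem1 eq_st eq_st count_mem1.
Qed.

Lemma count_upto0 (s t : seq nat) c : eq_upto0 s t -> count (ltn c) s = count (ltn c) t.
Proof.
move=> /permP/(_ (ltn c)); rewrite !count_filter.
have nz (r : seq nat) : count (predI (ltn c) (fun b => b != 0%R)) r = count (ltn c) r.
  by apply: eq_count => -[|b] /=; rewrite ?andbF ?andbT.
by rewrite !nz.
Qed.

Lemma filter_mkseq_nth s N :
  (forall c, N <= c -> nth 0 s c = 0) ->
  [seq a <- mkseq (nth 0 s) N | a != 0] = [seq a <- s | a != 0].
Proof.
elim: s N => [|a s IHs] N s0.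
  rewrite (@eq_in_filter _ _ pred0) ?filter_pred0 // => b.
  by case/mapP=> c _ ->; rewrite nth_nil.
case: N s0 => [|N] s0.
  rewrite [RHS](@eq_in_filter _ _ pred0) ?filter_pred0 // => b /(nthP 0)[c _ <-].
  by rewrite s0 ?eqxx.
rewrite /mkseq /= (iotaDl 1 0) -map_comp -[in RHS](IHs N) // => c le_Nc.
exact: (s0 c.+1).
Qed.

Lemma conj_part_upto0 s t : eq_upto0 s t -> conj_part s = conj_part t.
Proof.
have nz r : conj_part r = conj_part [seq a <- r | a != 0%R].
  rewrite /conj_part (_ : \max_(a <- r) a = \max_(a <- [seq a <- r | a != 0%R]) a)%N.
    apply: eq_mkseq => j; rewrite count_filter.
    by apply: eq_count => a /=; case: a => [|a]; rewrite ?andbT ?andbF.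
  rewrite big_filter [LHS](bigID (fun a => a != 0%R)) /= [X in maxn _ X]big1 ?maxn0 //.
  by move=> a; rewrite negbK => /eqP.
rewrite /eq_upto0 nz [RHS]nz => eq_st; rewrite /conj_part.
by rewrite (perm_big _ eq_st) /=; apply: eq_mkseq => j; apply: (permP eq_st).
Qed.

End Conjugation.

(** * Determinants and weighted permutation matrices *)

(** The two sides are the two Schur complements of the block matrix
    [1, -X; Y, 1].  Unlike characteristic polynomials, these determinants need no
    correction by a power of the variable when m and n differ, because det(1 + u A)
    does not see the eigenvalue 0. *)
Lemma det_1D_mulC (R : comNzRingType) m n (X : 'M[R]_(m, n)) (Y : 'M[R]_(n, m)) :
  \det (1%:M + X *m Y) = \det (1%:M + Y *m X).
Proof.
have detl k l (Z : 'M_(k + l)) W (U : 'M[R]_(k, l)) V : Z = block_mx 1%:M 0 V 1%:M *m block_mx 1%:M U 0 W ->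
    \det Z = \det W.
  by move=> ->; rewrite det_mulmx det_lblock det_ublock !det1 !mul1r.
have detr k l (Z : 'M_(k + l)) W (U : 'M[R]_(k, l)) V : Z = block_mx W U 0 1%:M *m block_mx 1%:M 0 V 1%:M ->
    \det Z = \det W.
  by move=> ->; rewrite det_mulmx det_lblock det_ublock !det1 !mulr1.
transitivity (\det (block_mx 1%:M (- X) Y 1%:M)).
  apply/esym/(detr _ _ _ _ (- X) Y); rewrite mulmx_block.
  by rewrite !mulmx1 !mulmx0 !mul1mx !mulNmx ?mul0mx !add0r addrK.
apply: (detl _ _ _ _ (- X) Y); rewrite mulmx_block.
by rewrite !(mul1mx, mul0mx, mulmxN, mulmx1, mulmx0, addr0, add0r) addrCA addNr addr0.
Qed.

Section FinMatrix.
Variables R : comNzRingType.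

(** Matrices are indexed by ordinals; this indexes them by finite types. *)
Definition fmx (S T : finType) (f : S -> T -> R) : 'M[R]_(#|S|, #|T|) :=
  \matrix_(i, j) f (enum_val i) (enum_val j).

Lemma eq_fmx (S T : finType) (f g : S -> T -> R) : f =2 g -> fmx f = fmx g.
Proof. by move=> eq_fg; apply/matrixP => i j; rewrite !mxE. Qed.

Lemma mul_fmx (S T U : finType) (f : S -> T -> R) (g : T -> U -> R) :
  fmx f *m fmx g = fmx (fun x z => \sum_y f x y * g y z).
Proof.
apply/matrixP => i k; rewrite !mxE (@big_enum_val _ _ _ _ T).
by apply: eq_bigr => j _; rewrite !mxE.
Qed.

Lemma tr_fmx (S T : finType) (f : S -> T -> R) :
  (fmx f)^T = fmx (fun y x => f x y).
Proof. by apply/matrixP => i j; rewrite !mxE. Qed.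

Variable T : finType.

(** The operator sending the basis vector y to [w y] times the vector [f y].
    Products and transposes (for involutive f) stay in this form, so identities
    between such operators are checked pointwise. *)
Definition wmx (w : T -> R) (f : T -> T) : 'M[R]_#|T| :=
  fmx (fun x y => w y *+ (x == f y)).

Lemma eq_wmx w w' f f' : w =1 w' -> f =1 f' -> wmx w f = wmx w' f'.
Proof. by move=> ww ff; apply: eq_fmx => x y; rewrite ww ff. Qed.

Lemma wmx0 w f : w =1 (fun=> 0) -> wmx w f = 0.
Proof. by move=> w0; apply/matrixP => i j; rewrite !mxE w0 mul0rn. Qed.

Lemma wmxN w f : - wmx w f = wmx (fun y => - w y) f.
Proof. by apply/matrixP => i j; rewrite !mxE mulNrn. Qed.

Lemma mul_wmx w f w' f' :
  wmx w f *m wmx w' f' = wmx (fun y => w (f' y) * w' y) (f \o f').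
Proof.
rewrite mul_fmx; apply: eq_fmx => x z /=.
rewrite (bigD1 (f' z)) //= eqxx mulrnAl big1 ?addr0 // => y ne_y.
by rewrite (negbTE ne_y) mulr0.
Qed.

Lemma tr_wmx w f : involutive f -> (wmx w f)^T = wmx (w \o f) f.
Proof.
move=> fK; rewrite tr_fmx; apply: eq_fmx => x y /=.
have -> : (y == f x) = (x == f y) by apply/eqP/eqP => ->.
by case: eqP => // ->.
Qed.

(** The coordinate projection onto the span of F. *)
Definition ind (F : {set T}) : 'M[R]_#|T| := wmx (fun t => (t \in F)%:R) id.

Lemma tr_ind F : (ind F)^T = ind F.
Proof. exact: tr_wmx. Qed.

Lemma ind_id F : ind F *m ind F = ind F.
Proof.
rewrite mul_wmx; apply: eq_wmx => t //=.
by case: (t \in F); rewrite ?mulr1 ?mulr0.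
Qed.

Lemma det_1D_ind u F : \det (1%:M + u *: ind F) = (1 + u) ^+ #|F|.
Proof.
have -> : 1%:M + u *: ind F
    = diag_mx (\row_i (1 + u * (enum_val i \in F)%:R)).
  apply/matrixP => i j; rewrite !mxE (inj_eq enum_val_inj).
  by case: eqP => [->|]; rewrite ?mulr1n ?mulr0n ?mulr0 ?addr0.
rewrite det_diag (eq_bigr (fun i => 1 + u * (@enum_val _ T i \in F)%:R)) => [|i _];
  last by rewrite mxE.
rewrite -(@big_enum_val _ _ _ _ T (fun t => 1 + u * (t \in F)%:R)) /=.
rewrite (bigID (mem F)) /= [X in _ * X]big1 => [|t /negbTE->]; last by rewrite mulr0 addr0.
rewrite mulr1 -prodr_const; apply: eq_bigr => t /= ->.
by rewrite mulr1.
Qed.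

End FinMatrix.

(** * Signed vertex deletions and their Clifford relations *)

Section Toggle.
Variables (n : nat) (P : finType).
Local Notation T := (P * {set 'I_n})%type.
Implicit Types (i j v : 'I_n) (A : {set 'I_n}) (t : T) (F : {set T}).

(** A pair (p, A) stands for the monomial p^2 times the product of the variables
    in A.  The operators below act on A alone and leave the square part p as a
    mere label. *)
Definition toggle j t : T := (t.1, [set i | (i \in t.2) (+) (i == j)]).

Lemma in_toggle i j t : (i \in (toggle j t).2) = (i \in t.2) (+) (i == j).
Proof. by rewrite inE. Qed.

Lemma toggle_ext t t' : t.1 = t'.1 -> t.2 =i t'.2 -> t = t'.
Proof. by case: t t' => [p A] [q B] /= -> /setP ->. Qed.

Lemma toggleK j : involutive (toggle j).
Proof. by move=> t; apply: toggle_ext => // i; rewrite !in_toggle -addbA addbb addbF. Qed.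

Lemma toggleC i j t : toggle i (toggle j t) = toggle j (toggle i t).
Proof. by apply: toggle_ext => // k; rewrite !in_toggle addbAC. Qed.

(** Shifting replaces j by i, so this is to be used with i before j. *)
Definition closed_shift F i j : bool :=
  [forall t : T in F, (i \notin t.2) && (j \in t.2) ==> (toggle i (toggle j t) \in F)].

Lemma closed_shiftP F i j :
  reflect (forall t, t \in F -> i \notin t.2 -> j \in t.2 -> toggle i (toggle j t) \in F)
          (closed_shift F i j).
Proof.
apply: (iffP 'forall_implyP) => shF t Ft => [it jt|].
  by have /implyP := shF t Ft; rewrite it jt; apply.
by apply/implyP => /andP[]; apply: shF.
Qed.

Definition incidence F j : nat := #|[set t : T in F | j \in t.2]|.

(** Replacing j by i, when i is absent, is an injection of the members
    containing j into those containing i. *)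
Lemma leq_incidence F i j : i != j -> closed_shift F i j -> (incidence F j <= incidence F i)%N.
Proof.
move=> ne_ij /closed_shiftP shF.
pose f t := if i \in t.2 then t else toggle i (toggle j t).
have f_inj : {in [set t : T in F | j \in t.2] &, injective f}.
  move=> t s; rewrite !inE /f => /andP[_ jt] /andP[_ js].
  case: ifPn => it; case: ifPn => is_ //.
  - by move=> def_t; move: jt; rewrite def_t !in_toggle js eqxx [j == i]eq_sym (negbTE ne_ij).
  - by move=> def_s; move: js; rewrite -def_s !in_toggle jt eqxx [j == i]eq_sym (negbTE ne_ij).
  - by move/(can_inj (toggleK i))/(can_inj (toggleK j)).
rewrite /incidence -(card_in_imset f_inj) subset_leq_card //.
apply/subsetP => _ /imsetP[t /[!inE] /andP[Ft jt] ->]; rewrite /f.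
case: ifPn => it; first by rewrite Ft.
by rewrite shF // !in_toggle eqxx (negbTE ne_ij) (negbTE it).
Qed.

Variable R : comNzRingType.

Definition sgn j A : R := \prod_(i < n | (i < j)%N) (-1) ^+ (i \in A).

Lemma sgn_sqr j A : sgn j A * sgn j A = 1.
Proof.
rewrite -big_split /= big1 // => i _.
by rewrite -expr2 sqrr_sign.
Qed.

Lemma sgn_toggle i j t : sgn i (toggle j t).2 = (-1) ^+ (j < i)%N * sgn i t.2.
Proof.
rewrite /sgn; have [lt_ji | le_ij] := boolP (j < i)%N; last first.
  rewrite mul1r; apply: eq_bigr => k lt_ki; rewrite in_toggle.
  by case: eqP lt_ki le_ij => [->->//|]; rewrite addbF.
rewrite (bigD1 j) //= [in RHS](bigD1 j) //= mulrA; congr (_ * _).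
  by rewrite in_toggle eqxx addbT signrN mulN1r.
by apply: eq_bigr => k /andP[_ /negbTE ne_kj]; rewrite in_toggle ne_kj addbF.
Qed.

Definition low j : 'M[R]_#|{: T}| := wmx (fun t => sgn j t.2 *+ (j \in t.2)) (toggle j).

Lemma tr_low j : (low j)^T = wmx (fun t => sgn j t.2 *+ (j \notin t.2)) (toggle j).
Proof.
rewrite tr_wmx; last exact: toggleK.
apply: eq_wmx => t //=.
by rewrite sgn_toggle ltnn mul1r in_toggle eqxx addbT.
Qed.

Lemma low_anticomm i j : low i *m low j = - (low j *m low i).
Proof.
rewrite !mul_wmx wmxN; apply: eq_wmx => t /=; last exact: toggleC.
rewrite !sgn_toggle !in_toggle.
have [->|] := eqVneq i j.
  by case: (j \in t.2); rewrite ?mulr0n ?mulr0 ?mul0r ?oppr0.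
rewrite -val_eqE /= ![_ (+) false]addbF; case: (i \in t.2); last by rewrite !mulr0n mul0r mulr0 oppr0.
case: (j \in t.2); last by rewrite !mulr0n mul0r mulr0 oppr0.
by case: ltngtP => // _ _; rewrite !mulr1n ?expr0 ?expr1; ring.
Qed.

Lemma low_sqr j : low j *m low j = 0.
Proof.
rewrite mul_wmx; apply: wmx0 => t /=.
by rewrite in_toggle eqxx addbT; case: (j \in _); rewrite ?mulr0n ?mulr0 ?mul0r.
Qed.

Lemma low_tr_anticomm i j : i != j -> low i *m (low j)^T = - ((low j)^T *m low i).
Proof.
move=> ne_ij; rewrite tr_low !mul_wmx wmxN; apply: eq_wmx => t /=; last exact: toggleC.
rewrite !sgn_toggle !in_toggle [j == i]eq_sym (negbTE ne_ij) !addbF.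
case: (i \in t.2); last by rewrite !mulr0n mul0r mulr0 oppr0.
case: (j \in t.2); first by rewrite !mulr0n mul0r mulr0 oppr0.
move: ne_ij; rewrite -val_eqE /=.
by case: ltngtP => // _ _; rewrite !mulr1n ?expr0 ?expr1; ring.
Qed.

Definition bd (s : seq 'I_n) : 'M[R]_#|{: T}| := \sum_(j <- s) low j.

Lemma bd_cons v s : bd (v :: s) = low v + bd s.
Proof. by rewrite /bd big_cons. Qed.

Lemma bd_low_anticomm s v : bd s *m low v = - (low v *m bd s).
Proof.
rewrite mulmx_suml mulmx_sumr -sumrN.
by apply: eq_bigr => j _; rewrite low_anticomm.
Qed.

(** The case v in s is excluded: the anticommutator of [low v] and its
    transpose is the identity. *)
Lemma bd_tr_low_anticomm s v : v \notin s -> bd s *m (low v)^T = - ((low v)^T *m bd s).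
Proof.
move=> sv; rewrite mulmx_suml mulmx_sumr -sumrN.
apply: eq_big_seq => j sj; rewrite low_tr_anticomm //.
by apply: contraNneq sv => <-.
Qed.

Lemma bd_sqr s : bd s *m bd s = 0.
Proof.
elim: s => [|v s IHs]; first by rewrite /bd big_nil mul0mx.
by rewrite bd_cons mulmxDl !mulmxDr low_sqr IHs bd_low_anticomm add0r addr0 subrr.
Qed.

Definition del v F : {set T} := [set t : T in F | v \notin t.2].
Definition link v F : {set T} := [set t : T | (v \notin t.2) && (toggle v t \in F)].

Lemma incidence_link v F : incidence F v = #|link v F|.
Proof.
rewrite /incidence -(card_imset _ (can_inj (toggleK v))); apply: eq_card => t.
apply/imsetP/idP => [[s /[!inE] /andP[Fs vs] ->]|].
  by rewrite in_toggle vs eqxx toggleK Fs.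
rewrite !inE => /andP[vt Ft]; exists (toggle v t); last by rewrite toggleK.
by rewrite !inE Ft eqxx (negbTE vt).
Qed.

(** Deletion and link of v partition F, up to removing v from the members that
    contain it; this is what makes the exponents of the determinant formula
    additive. *)
Lemma incidence_split v j F : v != j ->
  incidence F j = (incidence (del v F) j + incidence (link v F) j)%N.
Proof.
move=> ne_vj; rewrite /incidence -(cardsID [set t : T | v \in t.2]) addnC; congr (_ + _)%N.
  by apply: eq_card => t; rewrite !inE; do !case: (_ \in _).
rewrite -(card_imset _ (can_inj (toggleK v))); apply: eq_card => t.
apply/imsetP/idP => [[s /[!inE] /andP[/andP[Fs js] vs] ->]|].
  by rewrite !in_toggle vs js eqxx toggleK Fs [j == v]eq_sym (negbTE ne_vj).
rewrite !inE => /andP[/andP[vt Ft] jt]; exists (toggle v t); last by rewrite toggleK.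
by rewrite !inE Ft eqxx (negbTE vt) jt [j == v]eq_sym (negbTE ne_vj).
Qed.

Lemma closed_shift_del v i j F : v != i -> v != j ->
  closed_shift F i j -> closed_shift (del v F) i j.
Proof.
move=> vi vj /closed_shiftP shF; apply/closed_shiftP => t /[!inE] /andP[Ft vt] it jt.
by rewrite shF //= (negbTE vi) (negbTE vj) (negbTE vt).
Qed.

Lemma closed_shift_link v i j F : v != i -> v != j ->
  closed_shift F i j -> closed_shift (link v F) i j.
Proof.
move=> vi vj /closed_shiftP shF; apply/closed_shiftP => t /[!inE] /andP[vt Ft] it jt.
rewrite (negbTE vi) (negbTE vj) (negbTE vt) /= [toggle v _]toggleC [toggle v _]toggleC.
by apply: shF; rewrite ?in_toggle // [_ == v]eq_sym ?(negbTE vi) ?(negbTE vj) addbF.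
Qed.

Lemma low_link v F : low v *m ind R F = ind R (link v F) *m low v.
Proof.
rewrite !mul_wmx; apply: eq_wmx => t //=.
rewrite !inE eqxx addbT negbK toggleK.
by case: (v \in t.2); case: (t \in F); rewrite /= ?mulr1n ?mulr0n ?mulr1 ?mul1r ?mulr0 ?mul0r.
Qed.

Lemma low_del v F : low v *m ind R (del v F) = 0.
Proof.
rewrite mul_wmx; apply: wmx0 => t /=; rewrite inE.
by case: (v \in t.2); rewrite ?andbF ?mulr0 ?mulr0n ?mul0r.
Qed.

Lemma low_ind_link v F : low v *m ind R (link v F) = 0.
Proof.
rewrite mul_wmx; apply: wmx0 => t /=; rewrite inE.
by case: (v \in t.2); rewrite ?mulr0 ?mulr0n ?mul0r.
Qed.

Lemma low_tr_low_link v F : low v *m (low v)^T *m ind R (link v F) = ind R (link v F).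
Proof.
rewrite tr_low !mul_wmx; apply: eq_wmx => t /=; last exact: toggleK.
rewrite sgn_toggle ltnn mul1r !inE eqxx addbT.
by case: (v \in t.2) => /=; rewrite ?mulr0 // mulr1n sgn_sqr mul1r.
Qed.

(** [(low v)^T *m low v] is the projection onto the pairs containing v. *)
Lemma ind_split v F : ind R F = ind R (del v F) + (low v)^T *m low v *m ind R F.
Proof.
rewrite tr_low !mul_wmx; apply/matrixP => x y; rewrite !mxE /= toggleK inE.
rewrite sgn_toggle ltnn mul1r in_toggle eqxx addbT negbK.
case: (v \in _); case: (_ \in F); case: (_ == _); rewrite /= ?mulr0n ?mulr1n
  ?mulr0 ?addr0 ?add0r ?mulr1 ?sgn_sqr ?mul0r //.
by rewrite addr0.
Qed.

Lemma ind_bd_shadow (F G : {set T}) s :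
  (forall t j, t \in F -> j \in s -> j \in t.2 -> toggle j t \in G) ->
  ind R G *m (bd s *m ind R F) = bd s *m ind R F.
Proof.
move=> shFG; rewrite mulmxA mulmx_sumr !mulmx_suml; apply: eq_big_seq => j sj.
rewrite !mul_wmx; apply: eq_wmx => t //=.
case Ft: (t \in F); last by rewrite !mulr0.
case jt: (j \in t.2); last by rewrite !mulr0n mulr0.
by rewrite shFG // mul1r.
Qed.

(** The near-cone property: removing j from a member without v is the same as
    replacing j by v and then removing v. *)
Lemma ind_link_bd_del v s F : all (closed_shift F v) s -> v \notin s ->
  ind R (link v F) *m (bd s *m ind R (del v F)) = bd s *m ind R (del v F).
Proof.
move=> /allP shF sv; apply: ind_bd_shadow => t j /[!inE] /andP[Ft vt] sj jt.
have -> : v == j = false by apply: contraNF sv => /eqP->.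
by rewrite addbF vt (closed_shiftP _ _ _ (shF j sj)).
Qed.

End Toggle.

(** * The near-cone recursion *)

Section Cone.
Variables (R : realFieldType) (N : nat) (Q L A B : 'M[R]_N).
Hypotheses (symQ : Q^T = Q) (idQ : Q *m Q = Q) (QA : Q *m A = A) (BQ : B *m Q = B).
Hypotheses (BA : B *m A = 0) (LQ : L *m Q = 0) (LA : L *m A^T = 0).
Hypotheses (LLQ : L *m L^T *m Q = Q) (LLB : L *m L^T *m B = B).

(** Q is the projection onto the link of the apex, L the deletion of the apex,
    and A, B are the boundaries of the deletion and of the link.  With
    T = Q L + A and K = 1 - L^T B one has T T^T = Q + A A^T and
    Q K^T K Q = Q + B^T B, so cyclicity of the determinant replaces M M^T by
    (Q + A A^T)(Q + B^T B) = Q + A A^T + B^T B.  Here A A^T and B^T B annihilate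
    each other and live in the image of Q, on which 1 + u Q is the scalar 1 + u:
    factoring it out leaves the parameter u / (1 + u). *)
Lemma det_cone u (M := (1%:M - L^T *m B) *m (Q *m L + A)) :
  0 <= u ->
  \det (1%:M + u *: (M *m M^T))
  = \det (1%:M + u *: Q) * \det (1%:M + (u / (1 + u)) *: (A *m A^T))
    * \det (1%:M + (u / (1 + u)) *: (B *m B^T)).
Proof.
move=> u_ge0; have u1 : 1 + u != 0 by rewrite gt_eqF // ltr_pwDl.
have AQ : A^T *m Q = A^T by rewrite -{1}symQ -trmx_mul QA.
have QB : Q *m B^T = B^T by rewrite -{1}symQ -trmx_mul BQ.
have QL : Q *m L^T = 0 by rewrite -{1}symQ -trmx_mul LQ trmx0.
have AL : A *m L^T = 0 by rewrite -[A]trmxK -trmx_mul LA trmx0.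
pose K := 1%:M - L^T *m B; pose T := Q *m L + A.
have TT : T *m T^T = Q + A *m A^T.
  rewrite /T [(_ + _)^T]linearD /= trmx_mul symQ mulmxDl !mulmxDr -!mulmxA LA [A *m (_ *m _)]mulmxA AL.
  by rewrite mulmx0 mul0mx add0r addr0 [L *m _]mulmxA LLQ idQ.
have QT : Q *m T = T by rewrite /T mulmxDr mulmxA idQ QA.
have KQ : K *m Q = Q - L^T *m B by rewrite mulmxBl mul1mx -mulmxA BQ.
have KK : (K *m Q)^T *m (K *m Q) = Q + B^T *m B.
  rewrite KQ [(_ - _)^T]linearB /= trmx_mul trmxK symQ mulmxBl !mulmxBr idQ.
  rewrite -[_ *m L *m Q]mulmxA LQ mulmx0 [Q *m (_ *m _)]mulmxA QL mul0mx subr0 sub0r opprK.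
  by rewrite -mulmxA [L *m (_ *m _)]mulmxA LLB.
have AB : (A *m A^T) *m (B^T *m B) = 0.
  by rewrite -mulmxA [A^T *m _]mulmxA -trmx_mul BA trmx0 mul0mx mulmx0.
have ->: M *m M^T = (K *m Q) *m ((Q + A *m A^T) *m (K *m Q)^T).
  have -> : M = (K *m Q) *m T by rewrite -mulmxA QT.
  by rewrite trmx_mul -TT !mulmxA.
rewrite scalemxAr det_1D_mulC -scalemxAl -mulmxA KK.
have -> : (Q + A *m A^T) *m (Q + B^T *m B) = Q + (A *m A^T + B^T *m B).
  by rewrite mulmxDl !mulmxDr idQ mulmxA QB AB -mulmxA AQ addr0 addrAC addrA.
set s := u / (1 + u); have us : u = s + u * s by rewrite /s; field.
have -> : \det (1%:M + s *: (B *m B^T)) = \det (1%:M + s *: (B^T *m B)).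
  by rewrite scalemxAr det_1D_mulC -scalemxAl.
have QC : Q *m (A *m A^T) = A *m A^T by rewrite mulmxA QA.
have QE : Q *m (B^T *m B) = B^T *m B by rewrite mulmxA QB.
rewrite -!det_mulmx -[in RHS]mulmxA; congr (\det _).
move: (A *m A^T) (B^T *m B) AB QC QE => C E CE QC QE.
have -> : (1%:M + s *: C) *m (1%:M + s *: E) = 1%:M + s *: (C + E).
  rewrite mulmxDl mul1mx mulmxDr mulmx1 -scalemxAl -scalemxAr CE.
  by rewrite !scaler0 addr0 addrAC scalerDr addrA addrAC.
(* (1 + u) s = u for s = u / (1 + u), which is where the new parameter is forced. *)
have uCE : u *: (C + E) = s *: (C + E) + (u * s) *: (C + E).
  by rewrite -scalerDl -us.
rewrite mulmxDl mul1mx mulmxDr mulmx1 -scalemxAl -scalemxAr mulmxDr QC QE.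
by rewrite scalerA [u *: (Q + _)]scalerDr uCE -addrA; congr (_ + _); rewrite addrCA.
Qed.
End Cone.


Section Boundary.
Variables (R : realFieldType) (n : nat) (P : finType).
Local Notation T := (P * {set 'I_n})%type.
Implicit Types (i j v : 'I_n) (s : seq 'I_n) (F : {set T}).
Local Notation low := (@low n P R).
Local Notation bd := (@bd n P R).

(** This acts on the space of all pairs, which adds only zero eigenvalues to
    the Laplacian of F and spares a change of index set in the induction. *)
Definition up_laplacian s F : 'M[R]_#|{: T}| := (bd s *m ind R F) *m (bd s *m ind R F)^T.

Lemma up_laplacian_ind s F G : ind R G *m (bd s *m ind R F) = bd s *m ind R F ->
  up_laplacian s F *m ind R G = up_laplacian s F.
Proof.
rewrite /up_laplacian; move: (bd s *m _) => X GX.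
by rewrite -mulmxA; congr (_ *m _); rewrite -{2}GX trmx_mul tr_ind.
Qed.

Lemma det_up_laplacian_cons v s F u : v \notin s -> all (closed_shift F v) s -> 0 <= u ->
  \det (1%:M + u *: up_laplacian (v :: s) F)
  = (1 + u) ^+ incidence F v * \det (1%:M + (u / (1 + u)) *: up_laplacian s (del v F))
    * \det (1%:M + (u / (1 + u)) *: up_laplacian s (link v F)).
Proof.
move=> sv shF u_ge0.
(* Names with hidden bodies, so that the products below are compared as words
   in these letters only. *)
have [Q defQ] : {Q | Q = ind R (link v F)} by eexists.
have [P0 defP0] : {P0 | P0 = ind R (del v F)} by eexists.
have [D defD] : {D | D = bd s} by eexists.
have [L defL] : {L | L = low v} by eexists.
have [A defA] : {A | A = D *m P0} by eexists.
have [B defB] : {B | B = D *m Q} by eexists.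
have DD : D *m D = 0 by rewrite defD bd_sqr.
have DL : D *m L = - (L *m D) by rewrite defD defL bd_low_anticomm.
have DLt : D *m L^T = - (L^T *m D) by rewrite defD defL bd_tr_low_anticomm.
have symQ : Q^T = Q by rewrite defQ tr_ind.
have idQ : Q *m Q = Q by rewrite defQ ind_id.
have LQ : L *m Q = 0 by rewrite defL defQ low_ind_link.
have LLQ : L *m L^T *m Q = Q by rewrite defL defQ low_tr_low_link.
have LP : L *m ind R F = Q *m L by rewrite defL defQ low_link.
have QA : Q *m A = A by rewrite defA defQ defD defP0 ind_link_bd_del.
have BA : B *m A = 0 by rewrite defB -mulmxA QA defA mulmxA DD mul0mx.
have BQ : B *m Q = B by rewrite defB -mulmxA idQ.
have LA : L *m A^T = 0.
  by rewrite defA trmx_mul defP0 tr_ind mulmxA defL low_del mul0mx.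
have LLB : L *m L^T *m B = B.
  rewrite defB -[in LHS]mulmxA [L^T *m _]mulmxA -[L^T *m D]opprK -DLt.
  rewrite mulNmx mulmxN !mulmxA -[L *m D]opprK -DL.
  by rewrite !mulNmx opprK -!mulmxA [L *m _]mulmxA LLQ.
(* Split F by whether v is present; on the members containing v, the boundary
   without v is moved past the reinsertion of v, whence the minus sign. *)
have DP : bd (v :: s) *m ind R F = (1%:M - L^T *m B) *m (Q *m L + A).
  have BT : B *m (Q *m L + A) = D *m Q *m L.
    by rewrite mulmxDr BA addr0 mulmxA BQ defB.
  rewrite mulmxBl mul1mx -mulmxA BT bd_cons mulmxDl -defL -defD LP.
  rewrite [in D *m _](ind_split _ v F) mulmxDr -defP0 -defA -defL.
  rewrite -[L^T *m L *m _]mulmxA LP [D *m (_ *m _)]mulmxA DLt mulNmx.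
  by rewrite !mulmxA addrA.
rewrite /up_laplacian DP incidence_link -det_1D_ind.
by rewrite -defD -defP0 -defQ -defA -defB det_cone.
Qed.

(** One of these factors for each c < b multiply to 1 + u b, the contribution of
    an eigenvalue b. *)
Definition step_ratio (u : R) (c : nat) := (1 + u * c.+1%:R) / (1 + u * c%:R).

(** A spectrum conjugate to the vector of incidences, in determinant form.  The
    rational factors make this exponent formula hold without knowing that the
    incidences decrease. *)
Lemma det_up_laplacian s F u :
  uniq s -> pairwise (closed_shift F) s -> 0 <= u ->
  \det (1%:M + u *: up_laplacian s F)
  = \prod_(c < size s) step_ratio u c ^+ nth 0%N [seq incidence F j | j <- s] c.
Proof.
elim: s F u => [|v s IHs] F u.
  by move=> _ _ _; rewrite big_ord0 /up_laplacian /bd big_nil !mul0mx scaler0 addr0 det1.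
rewrite cons_uniq pairwise_cons => /andP[sv us] /andP[vF sF] u_ge0.
have u1 : 0 < 1 + u by rewrite ltr_pwDl.
have s_ge0 : 0 <= u / (1 + u) by rewrite divr_ge0 // ltW.
have neq_v i : i \in s -> v != i by move=> si; apply: contraNneq sv => ->.
rewrite det_up_laplacian_cons // !IHs //; last 2 first.
- apply: (sub_in_pairwise (P := mem s)) sF; last exact/allP.
  by move=> i j /neq_v vi /neq_v vj; apply: closed_shift_link.
- apply: (sub_in_pairwise (P := mem s)) sF; last exact/allP.
  by move=> i j /neq_v vi /neq_v vj; apply: closed_shift_del.
rewrite big_ord_recl /= -mulrA; congr (_ * _).
  by rewrite /step_ratio mulr1 mulr0 addr0 divr1.
rewrite -big_split /=; apply: eq_bigr => c _; rewrite -exprD.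
(* 1 + s c = (1 + u (c + 1)) / (1 + u), and the denominators 1 + u cancel. *)
have -> : step_ratio (u / (1 + u)) c = step_ratio u c.+1.
  rewrite /step_ratio -!natr1; field.
  by rewrite !gt_eqF // ltr_pwDl // mulr_ge0 // natr1 ler0n.
congr (_ ^+ _); rewrite add0n !(nth_map v) //; apply/esym/incidence_split.
by apply: neq_v; exact: mem_nth.
Qed.

End Boundary.

(** * Spectra from determinants *)

Section Multisets.
Variable R : realFieldType.
Implicit Types (p q : {poly R}) (s t : seq R).

(** The negative integers are enough roots for the difference. *)
Lemma eq_poly_neg p q : (forall x, x < 0 -> p.[x] = q.[x]) -> p = q.
Proof.
move=> eq_pq; apply/eqP; rewrite -subr_eq0; apply/eqP.
pose rs : seq R := [seq - i.+1%:R | i <- iota 0 (size (p - q))].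
apply: (@roots_geq_poly_eq0 _ _ rs); last by rewrite size_map size_iota.
  apply/allP => _ /mapP[i _ ->]; rewrite rootE !hornerE eq_pq ?subrr //.
  by rewrite oppr_lt0 ltr0Sn.
rewrite map_inj_uniq ?iota_uniq // => i j /oppr_inj /eqP.
by rewrite eqr_nat eqSS => /eqP.
Qed.

Lemma prod_horner_neg s x : x < 0 ->
  \prod_(a <- s) (x - a) = x ^+ size s * \prod_(a <- s) (1 + - x^-1 * a).
Proof.
move=> x_lt0; have x0 : x != 0 by rewrite lt_eqF.
elim: s => [|a s IHs]; first by rewrite !big_nil expr0 mulr1.
by rewrite !big_cons IHs exprS; field.
Qed.

Lemma horner_prod_XsubC s x :
  (\prod_(a <- s) ('X - a%:P)).[x] = \prod_(a <- s) (x - a).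
Proof. by rewrite horner_prod; apply: eq_bigr => a _; rewrite hornerXsubC. Qed.

(** Padding both multisets with zeros to a common size turns the hypothesis into
    an equality of characteristic polynomials at all negative points x = - 1/u. *)
Lemma eq_upto0_prod s t :
  (forall u, 0 < u -> \prod_(a <- s) (1 + u * a) = \prod_(a <- t) (1 + u * a)) ->
  eq_upto0 s t.
Proof.
move=> eq_st.
have /prod_XsubC_eq/(perm_filter (fun a => a != 0)) :
    \prod_(a <- nseq (size t) 0 ++ s) ('X - a%:P)
    = \prod_(a <- nseq (size s) 0 ++ t) ('X - a%:P).
  apply: eq_poly_neg => x x_lt0; rewrite !horner_prod_XsubC.
  rewrite !big_cat /= !prod_horner_neg // eq_st ?oppr_gt0 ?invr_lt0 //.
  rewrite !size_nseq !big_nseq mulr0 addr0 !iter_mulr_1 !expr1n !mulr1.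
  by rewrite !mulrA -!exprD addnC.
by rewrite !filter_cat !filter_nseq eqxx.
Qed.

Lemma nat_seq (s : seq R) : (forall a, a \in s -> exists b : nat, a = b%:R) ->
  exists lam : seq nat, s = [seq b%:R | b <- lam].
Proof.
elim: s => [|a s IHs] nat_s; first by exists [::].
have [b ->] := nat_s a (mem_head _ _).
have [|lam ->] := IHs; first by move=> c sc; apply: nat_s; rewrite inE sc orbT.
by exists (b :: lam).
Qed.

Lemma eq_upto0_natr (s t : seq nat) :
  eq_upto0 [seq b%:R : R | b <- s] [seq b%:R | b <- t] = eq_upto0 s t.
Proof.
have nz (r : seq nat) : [seq a <- [seq b%:R : R | b <- r] | a != 0]
    = [seq b%:R | b <- [seq b <- r | b != 0]].
  by rewrite filter_map; congr map; apply: eq_filter => b; rewrite /= pnatr_eq0.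
rewrite /eq_upto0 !nz; apply/idP/idP; last exact: perm_map.
by apply: perm_map_inj => a b /eqP; rewrite eqr_nat => /eqP.
Qed.

Lemma prod_step_ratio (u : R) b N : 0 <= u -> (b <= N)%N ->
  1 + u * b%:R = \prod_(c < N) step_ratio u c ^+ (c < b)%N.
Proof.
move=> u_ge0 /subnKC <-.
have pos c : 1 + u * c%:R != 0 by rewrite gt_eqF // ltr_pwDl // mulr_ge0.
rewrite big_split_ord /= [X in _ = _ * X]big1 ?mulr1 => [|c _]; last by rewrite ltnNge leq_addr.
rewrite (eq_bigr (fun c : 'I_b => step_ratio u c)) => [|c _]; last by rewrite ltn_ord.
elim: b => [|b IHb]; first by rewrite big_ord0 mulr0 addr0.
by rewrite big_ord_recr /= -IHb /step_ratio [RHS]mulrC divfK.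
Qed.

Lemma prod_count_step_ratio (u : R) (lam : seq nat) N : 0 <= u ->
  all (fun b => b <= N)%N lam ->
  \prod_(b <- lam) (1 + u * b%:R) = \prod_(c < N) step_ratio u c ^+ count (ltn c) lam.
Proof.
move=> u_ge0; elim: lam => [_|b lam IHlam] /=.
  by rewrite big_nil big1.
case/andP=> le_bN /IHlam IH; rewrite big_cons IH (prod_step_ratio u_ge0 le_bN).
by rewrite -big_split; apply: eq_bigr => c _; rewrite exprD.
Qed.

Lemma prod_char_poly_roots r (A : 'M[R]_r) s u : 
  char_poly A = \prod_(a <- s) ('X - a%:P) -> 0 < u ->
  \prod_(a <- s) (1 + u * a) = \det (1%:M + u *: A).
Proof.
move=> def_s u_gt0; have u0 : u != 0 by rewrite gt_eqF.
have size_s : size s = r.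
  have := size_char_poly A; rewrite def_s size_prod_XsubC => -[//].
have := congr1 (fun p => p.[- u^-1]) def_s.
rewrite horner_prod_XsubC.
rewrite prod_horner_neg ?oppr_lt0 ?invr_gt0 // invrN opprK invrK size_s.
have -> : (char_poly A).[- u^-1] = (- u^-1) ^+ r * \det (1%:M + u *: A).
  rewrite -detZ -horner_evalE -det_map_mx; congr (\det _).
  apply/matrixP => i j; rewrite !mxE /= horner_evalE !hornerE hornerMn !hornerE.
  by case: eqP => _; rewrite ?mulr1n ?mulr0n; field.
by move/(mulfI _) => -> //; rewrite expf_neq0 // oppr_eq0 invr_eq0.
Qed.

End Multisets.

(** * Monomials of a multicomplex as pairs (square part, odd support) *)

Section Monomials.
Variables (n : nat) (M : {fset 'X_{1..n}}).
Hypotheses (cM : multicomplex M).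
Local Notation P := {: square_roots M}.
Local Notation T := (P * {set 'I_n})%type.
Implicit Types (t : T) (d k : nat) (A : {set 'I_n}).

Definition sqfree_mon A : 'X_{1..n} := [multinom (i \in A : nat) | i < n].
Definition mon t : 'X_{1..n} := (val t.1 *+ 2 + sqfree_mon t.2)%MM.

Lemma monE t i : mon t i = (val t.1 i * 2 + (i \in t.2))%N.
Proof. by rewrite /mon mnmDE mulmnE mnmE. Qed.

Lemma odd_mon t i : odd (mon t i) = (i \in t.2).
Proof. by rewrite monE muln2 oddD odd_double oddb. Qed.

Lemma mon_inj : injective mon.
Proof.
move=> t t' eq_tt'; have e2 : t.2 = t'.2 by apply/setP => i; rewrite -!odd_mon eq_tt'.
apply: toggle_ext; last by rewrite e2.
apply/val_inj/mnmP => i; have := congr1 (fun m : 'X_{1..n} => m i) eq_tt'.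
by rewrite !monE e2 => /addIn/eqP; rewrite eqn_pmul2r // => /eqP.
Qed.

(** The square part of m is a monomial whose square divides m, so it belongs to
    [square_roots M] by closure under divisors. *)
Lemma mon_surj m : m \in M -> exists t, mon t = m.
Proof.
move=> Mm; pose p : 'X_{1..n} := [multinom (m i)./2 | i < n].
have sqp : p \in square_roots M.
  rewrite mem_square_roots //; apply: cM Mm; apply/mnm_lepP => i.
  by rewrite mulmnE mnmE muln2 -{2}(odd_double_half (m i)) leq_addl.
exists ([` sqp]%fset, [set i | odd (m i)]); apply/mnmP => i.
by rewrite monE inE /= mnmE muln2 addnC odd_double_half.
Qed.

Definition lev d : {set T} := [set t | mon t \in level M d].

Lemma mem_lev d t : (t \in lev d) = (mon t \in M) && (mdeg (mon t) == d).
Proof. by rewrite !inE. Qed.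

Lemma perm_level d : perm_eq (level M d) [seq mon t | t <- enum (lev d)].
Proof.
apply: uniq_perm; first exact: fset_uniq.
  by rewrite map_inj_uniq ?enum_uniq //; apply: mon_inj.
move=> m; apply/idP/mapP => [lm | [t]]; last by rewrite mem_enum inE => lt ->.
have [t def_m] : exists t, mon t = m.
  by apply: mon_surj; move: lm; rewrite !inE => /andP[].
by exists t; [rewrite mem_enum inE def_m | rewrite def_m].
Qed.

Lemma incidence_sum (F : {set T}) j : incidence F j = (\sum_(t in F) (j \in t.2))%N.
Proof.
rewrite /incidence -sum1_card big_mkcond [RHS]big_mkcond.
by apply: eq_bigr => t _; rewrite inE; case: (t \in F); case: (j \in _).
Qed.

Lemma sum_odd_level d j :
  (\sum_(m <- level M d) odd (m j))%N = incidence (lev d) j.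
Proof.
rewrite (perm_big _ (perm_level d)) big_map big_enum incidence_sum.
by apply: eq_bigr => t _; rewrite odd_mon.
Qed.

(** The members of level d with square part p: a copy of the faces of M^(p^2)
    of degree d - 2 deg p. *)
Definition fiber d (p : P) : {set T} := [set t in lev d | t.1 == p].

Lemma mem_fiber d p t : (t \in fiber d p) = (t \in lev d) && (t.1 == p).
Proof. by rewrite [LHS]inE. Qed.

Lemma incidence_fiber d j :
  incidence (lev d) j = (\sum_(p : P) incidence (fiber d p) j)%N.
Proof.
rewrite incidence_sum (partition_big (fun t => t.1) predT) //=.
apply: eq_bigr => p _; rewrite incidence_sum; apply: eq_bigl => t.
by rewrite mem_fiber.
Qed.

Lemma mdeg_mon t : mdeg (mon t) = (2 * mdeg (val t.1) + mdeg (sqfree_mon t.2))%N.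
Proof. by rewrite /mon mdegD mdegMn mulnC. Qed.

Lemma sqfree_mon_squarefree A : squarefree (sqfree_mon A).
Proof. by apply/forallP => i; rewrite mnmE leq_b1. Qed.

Lemma squarefreeP m : squarefree m -> m = sqfree_mon [set i | m i != 0%N].
Proof.
move=> /forallP sf; apply/mnmP => i; rewrite mnmE inE.
by case: (m i) (sf i) => [|[]].
Qed.

Lemma sqfree_mon_inj : injective sqfree_mon.
Proof.
move=> A B eqAB; apply/setP => i.
by have /(congr1 (fun m : 'X_{1..n} => m i)) := eqAB; rewrite !mnmE; do 2!case: (i \in _).
Qed.

Lemma mem_sqlink_level d (p : P) A j : (2 * mdeg (val p) <= d)%N ->
  (sqfree_mon A \in [fset m in level (sqlink M (val p)) (d - 2 * mdeg (val p)) | (U_(j) <= m)%MM]%fset)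
  = ((p, A) \in lev d) && (j \in A).
Proof.
move=> le_pd; rewrite mem_lev mdeg_mon /= !inE /= sqfree_mon_squarefree lep1mP mnmE eqb0 negbK /=.
rewrite -(eqn_add2l (2 * mdeg (val p))) subnKC //; congr (_ && _ && _).
by apply: andb_idl; apply: cM; apply: lem_addl.
Qed.

Lemma incidence_fiber_degree d (p : P) : (2 * mdeg (val p) <= d)%N ->
  [seq incidence (fiber d p) j | j : 'I_n]
  = degree_vector (sqlink M (val p)) (d - 2 * mdeg (val p)).
Proof.
move=> le_pd; apply: eq_map => j; rewrite /incidence.
have -> : [set t : T in fiber d p | j \in t.2]
    = [set (p, A) | A in [set A | ((p, A) \in lev d) && (j \in A)]].
  apply/setP => t; apply/idP/imsetP => [|[A /[swap] ->]]; last first.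
    by rewrite !inE eqxx andbT.
  rewrite [in X in X -> _]inE => /andP[]; rewrite mem_fiber => /andP[lt /eqP tp] jt.
  by exists t.2; rewrite -?tp -?surjective_pairing // inE -surjective_pairing lt.
rewrite card_imset => [|A B [] //]; rewrite cardE -(size_map sqfree_mon).
apply/perm_size/uniq_perm.
- by rewrite map_inj_uniq ?enum_uniq //; apply: sqfree_mon_inj.
- exact: fset_uniq.
move=> m; apply/mapP/idP => [[A] | Gm].
  by rewrite mem_enum inE -mem_sqlink_level // => GA ->.
have def_m : m = sqfree_mon [set i | m i != 0%N].
  by apply: squarefreeP; move: Gm; rewrite !inE => /andP[/andP[/and3P[]]].
exists [set i | m i != 0%N] => //.
by rewrite mem_enum inE -mem_sqlink_level // -def_m.
Qed.

Lemma fiber_high d (p : P) : (d < 2 * mdeg (val p))%N -> fiber d p = set0.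
Proof.
move=> lt_dp; apply/setP => t; rewrite in_set0 inE mem_lev mdeg_mon.
by apply/negP => /andP[/andP[_ /eqP def_d] /eqP def_p]; move: lt_dp; rewrite -def_d def_p; lia.
Qed.

(** Shiftedness is relative to the support, so the induction runs only over
    these vertices; the others have incidence 0. *)
Definition vertices : seq 'I_n := [seq j <- enum 'I_n | (U_(j) \in M)%MM].

Lemma vertices_uniq : uniq vertices.
Proof. by rewrite filter_uniq ?enum_uniq. Qed.

Lemma mem_vertices t j : mon t \in M -> j \in t.2 -> j \in vertices.
Proof.
move=> Mt jt; rewrite mem_filter mem_enum andbT; apply: cM Mt.
by rewrite lep1mP; rewrite monE jt addn1.
Qed.

Lemma vertices_ltn : pairwise (fun i j : 'I_n => i < j)%N vertices.
Proof.
apply: pairwise_filter; rewrite -[pairwise _ _](pairwise_map val ltn) val_enum_ord.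
by rewrite -sorted_pairwise ?iota_ltn_sorted //; apply: ltn_trans.
Qed.

Lemma mon_toggle t j : j \in t.2 -> (U_(j) + mon (toggle j t))%MM = mon t.
Proof.
move=> jt; apply/mnmP => i; rewrite mnmDE mnm1E !monE in_toggle /= [i == j]eq_sym.
by case: eqP => [<-|_]; rewrite ?addbF ?add0n // jt /= addn0 addnC.
Qed.

Hypothesis sM : shifted M.

Lemma lev_shifted d : pairwise (closed_shift (lev d)) vertices.
Proof.
apply: (sub_in_pairwise (P := mem vertices)) vertices_ltn; last exact/allP.
move=> i j; rewrite !mem_filter => /andP[Mi _] _ lt_ij; apply/closed_shiftP => t.
rewrite !mem_lev => /andP[Mt dt] it jt.
have ne_ij : i == j = false by rewrite -val_eqE /= ltn_eqF.
have ijt : i \in (toggle i (toggle j t)).2.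
  by rewrite !in_toggle eqxx ne_ij (negbTE it).
rewrite -(mon_toggle ijt) toggleK mdegD mdeg1 -(mdeg1 j) -mdegD mon_toggle // dt andbT.
by apply: (sM lt_ij) => //; rewrite mon_toggle.
Qed.

(** Shifting moves only the odd support, hence preserves the square part. *)
Lemma fiber_shifted d p : pairwise (closed_shift (fiber d p)) vertices.
Proof.
apply: sub_pairwise (lev_shifted d) => i j /closed_shiftP shF; apply/closed_shiftP => t.
by rewrite !mem_fiber => /andP[lt ->] it jt; rewrite andbT; apply: shF.
Qed.

Lemma sorted_incidence (F : {set T}) : pairwise (closed_shift F) vertices ->
  sorted geq [seq incidence F j | j <- vertices].
Proof.
move=> shF; rewrite sorted_pairwise; last exact/rev_trans/leq_trans.
have := vertices_uniq; rewrite uniq_pairwise pairwise_map => ne.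
have := conj ne shF => /andP; rewrite -pairwise_relI.
apply: sub_pairwise => i j /andP[]; exact: leq_incidence.
Qed.

Lemma incidence_vertices0 d j : j \notin vertices -> incidence (lev d) j = 0%N.
Proof.
move=> sj; apply: eq_card0 => t; rewrite [LHS]inE.
apply/negP => /andP[]; rewrite mem_lev => /andP[Mt _] jt.
by case/negP: sj; apply: mem_vertices Mt jt.
Qed.

Lemma incidence_fiber_vertices0 d (p : P) j : j \notin vertices -> incidence (fiber d p) j = 0%N.
Proof.
move=> /(incidence_vertices0 d); rewrite incidence_fiber => /eqP.
by rewrite sum_nat_eq0 => /forallP/(_ p)/eqP.
Qed.

Lemma filter_vertices (f : 'I_n -> nat) : (forall j, j \notin vertices -> f j = 0%N) ->
  [seq a <- [seq f j | j <- vertices] | a != 0] = [seq a <- [seq f j | j : 'I_n] | a != 0].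
Proof.
move=> f0; rewrite [LHS]filter_map [RHS]filter_map; congr map; rewrite /vertices -filter_predI.
apply: eq_filter => j /=; apply: andb_idr => fj.
apply: contraNT fj => Mj; apply/eqP/f0; by rewrite mem_filter (negbTE Mj).
Qed.

Lemma count_conj_fiber d (p : P) c :
  count (ltn c) (conj_part [seq incidence (fiber d p) j | j : 'I_n])
  = nth 0%N [seq incidence (fiber d p) j | j <- vertices] c.
Proof.
rewrite -count_conj_part; last exact/sorted_incidence/fiber_shifted.
congr count; apply: conj_part_upto0; rewrite /eq_upto0 filter_vertices //.
exact: incidence_fiber_vertices0.
Qed.

End Monomials.

(** * The spectrum of the Laplacian of a shifted multicomplex *)

Section Laplacian.
Variables (R : rcfType) (n : nat) (M : {fset 'X_{1..n}}).
Hypotheses (cM : multicomplex M).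
Local Notation P := {: square_roots M}.
Local Notation T := (P * {set 'I_n})%type.
Implicit Types (t : T) (d k : nat).
Local Notation vs := (vertices M).

(** The isometric inclusion of the level into the space of all pairs, transposed:
    conjugating by it transports the boundary to [bd]. *)
Definition level_incl d : 'M[R]_(#|{: level M d}|, #|{: T}|) :=
  fmx (fun (x : level M d) t => (val x == mon t)%:R).

Lemma tr_level_incl_mul d : (level_incl d)^T *m level_incl d = ind R (lev M d).
Proof.
rewrite tr_fmx mul_fmx; apply: eq_fmx => t t'; rewrite inE.
have [lt | nlt] := boolP (mon t' \in level M d); last first.
  rewrite mul0rn big1 // => x _; case: (eqVneq (val x) (mon t')) => [ex|]; last by rewrite mulr0.
  by case/negP: nlt; rewrite -ex; exact: valP.
rewrite (bigD1 [` lt]%fset) //= eqxx mulr1 big1 ?addr0 => [|x ne_x].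
  by rewrite (inj_eq (@mon_inj _ _)) eq_sym.
case: (eqVneq (val x) (mon t')) => [ex|]; last by rewrite mulr0.
by case/eqP: ne_x; apply: val_inj.
Qed.

(** Only the parity of the exponents enters the signs, and only the vertices of M
    can have an odd exponent. *)
Lemma boundaryE t b :
  mon t \in M ->
  (boundary R (mon t))@_b
  = \sum_(j <- vs) (sgn R j t.2 *+ (j \in t.2)) *+ (b == mon (toggle j t)).
Proof.
move=> Mt; rewrite /boundary raddf_sum /= /vertices big_filter big_enum_cond /=.
rewrite (bigID (fun j => (U_(j) \in M)%MM)) /= [X in _ + X]big1 ?addr0 => [|j notMj].
  apply: eq_bigr => j _; rewrite mcoeffZ mcoeffX odd_mon.
  have [jt | njt] := boolP (j \in t.2); last by rewrite mulr0 mul0r mul0rn.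
  have -> : (mon t - U_(j))%MM = mon (toggle j t) by rewrite -(mon_toggle jt) addmC addmK.
  rewrite mulr1 mulr1n eq_sym mulr_natr; congr (_ *+ _).
  rewrite /sgn prodrXr -signr_odd -[RHS]signr_odd; congr (_ ^+ _).
  rewrite !(big_morph odd oddD (erefl _)); congr (nat_of_bool _).
  by apply: eq_bigr => i _; rewrite odd_mon oddb.
rewrite odd_mon; have [jt|] := boolP (j \in t.2); last by rewrite mulr0 scale0r mcoeff0.
by case/negP: notMj; have := mem_vertices cM Mt jt; rewrite mem_filter => /andP[].
Qed.

Lemma boundary_mxE d :
  boundary_mx R M d = level_incl d *m bd P R vs *m (level_incl d.+1)^T.
Proof.
have bdE : bd P R vs = fmx (fun s t : T => \sum_(j <- vs) (sgn R j t.2 *+ (j \in t.2)) *+ (s == toggle j t)).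
  by apply/matrixP => i j; rewrite mxE /bd summxE; apply: eq_bigr => k _; rewrite mxE.
rewrite bdE tr_fmx !mul_fmx; apply/matrixP => i j; rewrite !mxE.
move: (enum_val i) (enum_val j) => x y.
have memM e (z : level M e) : val z \in M by have := valP z; rewrite !inE => /andP[].
have [s def_s] := mon_surj cM (memM _ x); have [t def_t] := mon_surj cM (memM _ y).
rewrite (bigD1 t) //= def_t eqxx mulr1 [X in _ + X]big1 ?addr0 => [|t' ne_t]; last first.
  by rewrite -def_t (inj_eq (@mon_inj _ _)) [t == _]eq_sym (negbTE ne_t) mulr0.
rewrite (bigD1 s) //= def_s eqxx mul1r [X in _ + X]big1 ?addr0 => [|s' ne_s]; last first.
  by rewrite -def_s (inj_eq (@mon_inj _ _)) [s == _]eq_sym (negbTE ne_s) mul0r.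
rewrite -def_t boundaryE ?def_t //; apply: eq_bigr => k _.
by rewrite -def_s (inj_eq (@mon_inj _ _)).
Qed.

Lemma ind_lev_bd d :
  ind R (lev M d) *m (bd P R vs *m ind R (lev M d.+1)) = bd P R vs *m ind R (lev M d.+1).
Proof.
apply: ind_bd_shadow => t j; rewrite !mem_lev => /andP[Mt /eqP dt] _ jt.
rewrite (cM _ Mt) /=; last by rewrite -(mon_toggle jt) lem_addl.
by move: dt; rewrite -(mon_toggle jt) mdegD mdeg1 add1n => -[->].
Qed.

(** The level-d pairs contain the image of the restricted boundary, so passing
    between the level and the space of all pairs is harmless. *)
Lemma det_laplacian d u :
  \det (1%:M + u *: laplacian R M d) = \det (1%:M + u *: up_laplacian R vs (lev M d.+1)).
Proof.
have -> : laplacian R M d = level_incl d *m (up_laplacian R vs (lev M d.+1) *m (level_incl d)^T).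
  rewrite /laplacian boundary_mxE trmx_mul trmxK [(level_incl d *m _)^T]trmx_mul.
  rewrite /up_laplacian trmx_mul tr_ind -!mulmxA; congr (_ *m (_ *m _)).
  by rewrite [LHS]mulmxA tr_level_incl_mul [RHS]mulmxA ind_id.
have : up_laplacian R vs (lev M d.+1) *m ind R (lev M d) = up_laplacian R vs (lev M d.+1).
  exact/up_laplacian_ind/ind_lev_bd.
move: (up_laplacian _ _ _) => W WI.
by rewrite scalemxAr det_1D_mulC -scalemxAl -mulmxA tr_level_incl_mul WI.
Qed.

Hypothesis sM : shifted M.

(** Both determinant formulas have the factor [step_ratio u c] with the same
    exponent: the incidence of the c-th vertex is the number of parts of the
    conjugate that exceed c. *)
Lemma spectrum_conj d :
  eq_upto0 (spectrum R M d)
    [seq b%:R | b <- conj_part [seq incidence (lev M d.+1) j | j <- vs]].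
Proof.
set e := [seq _ | j <- vs].
have e_sorted : sorted geq e by apply/sorted_incidence/lev_shifted.
apply: eq_upto0_prod => u u_gt0.
have [_ /eqP def_s] := andP (spectrumP R M d).
rewrite (prod_char_poly_roots def_s u_gt0) det_laplacian.
rewrite det_up_laplacian ?vertices_uniq ?(ltW u_gt0) //; last exact: lev_shifted.
rewrite big_map (@prod_count_step_ratio _ _ _ (size vs)) ?(ltW u_gt0) //.
  by apply: eq_bigr => c _; rewrite count_conj_part.
apply/allP => b /mapP[c _ ->].
by rewrite (leq_trans (count_size _ _)) // size_map.
Qed.

Lemma spectrum_nat d : exists lam : seq nat,
  spectrum R M d = [seq b%:R | b <- lam]
  /\ eq_upto0 lam (conj_part [seq incidence (lev M d.+1) j | j <- vs]).
Proof.
have sp := spectrum_conj d.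
have [|lam def_sp] := @nat_seq _ (spectrum R M d).
  move=> a sa; have [->|a0] := eqVneq a 0; first by exists 0.
  have : a \in [seq a <- spectrum R M d | a != 0] by rewrite mem_filter a0.
  by rewrite (perm_mem sp) mem_filter => /andP[_ /mapP[b _ ->]]; exists b.
by exists lam; split; rewrite // -(eq_upto0_natr R) -def_sp.
Qed.

End Laplacian.

Theorem theorem9 (R : realType) (n : nat) (M : {fset 'X_{1..n}})
    (hM : multicomplex M) (sM : shifted M) (k : nat) (hk : (1 <= k)%N) :
  [/\ eq_upto0 (spectrum R M k.-1)
        [seq b%:R | b <- flatten
          [seq conj_part (degree_vector (sqlink M p) (k - 2 * mdeg p))
          | p <- square_roots M & (2 * mdeg p <= k)%N]],
      forall (d : nat) (a : R),
        eigenvalue (laplacian R M d) a -> exists b : nat, a = b%:R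
    & exists lam : seq nat,
        spectrum R M k.-1 = [seq b%:R | b <- lam]
        /\ eq_upto0 (conj_part lam) (parity_vector_sum M k)].
Proof.
have [lam []] := spectrum_nat R hM sM k.-1; rewrite prednK // => def_sp lam_conj.
have e_sorted := sorted_incidence (lev_shifted sM k).
split.
- rewrite def_sp eq_upto0_natr; apply: eq_upto0_count => c.
  rewrite (count_upto0 c lam_conj) count_conj_part // count_flatten -map_comp sumnE big_map.
  rewrite big_filter big_seq_fsetE /=.
  (* Threshold counts are incidences, hence additive over the square parts. *)
  have -> : nth 0%N [seq incidence (lev M k) j | j <- vertices M] c
      = (\sum_(p : {: square_roots M})
          nth 0%N [seq incidence (fiber k p) j | j <- vertices M] c)%N.
    have [lt_c | le_c] := ltnP c (size (vertices M)); last first.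
      by rewrite nth_default ?size_map // big1 // => p _; rewrite nth_default ?size_map.
    have v : 'I_n by case: (vertices M) lt_c.
    rewrite (nth_map v) // incidence_fiber; apply: eq_bigr => p _.
    by rewrite (nth_map v).
  rewrite [RHS]big_mkcond; apply: eq_bigr => p _; rewrite -count_conj_fiber //.
  (* Square parts with 2 deg p > k contribute an empty family. *)
  case: leqP => [le_pk | lt_kp]; first by rewrite incidence_fiber_degree.
  rewrite fiber_high // /conj_part big_map big1 // => j _.
  by apply: eq_card0 => t; rewrite !inE.
- move=> d a; rewrite eigenvalue_root_char.
  have [_ /eqP ->] := andP (spectrumP R M d); rewrite root_prod_XsubC.
  have [mu [-> _]] := spectrum_nat R hM sM d.
  by case/mapP => b _ ->; exists b.
exists lam; split => //.
have -> : parity_vector_sum M k = [seq incidence (lev M k) j | j : 'I_n].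
  by apply: eq_map => j; rewrite sum_odd_level.
rewrite /eq_upto0 -(filter_vertices (M := M)); last by move=> j; apply: incidence_vertices0.
rewrite (conj_part_upto0 lam_conj).
set e := [seq _ | j <- _] in e_sorted *.
rewrite {1}/conj_part (eq_mkseq (fun c => count_conj_part c e_sorted)) filter_mkseq_nth // => c le_c.
rewrite -count_conj_part //; apply/eqP; rewrite -leqn0 leqNgt -has_count.
apply/hasPn => b sb; rewrite -leqNgt (leq_trans _ le_c) //.
exact: (@leq_bigmax_seq _ _ xpredT id _ sb).
Qed.
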